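(* Fix an integer $r\geq3$. For all $\delta>0$ there exist $0<\epsilon<1$ and $M$ such that for all $t>M$: if $R\in\tilde M_r(t)$ and $W(R)>m(r)^{(1-\epsilon)\binom t2}$, then $R$ is $\delta$-close to some element of $\tilde C_r(t)$.
   Context: $[r]=\{1,\ldots,r\}$, $[i,j]=\{i,\ldots,j\}$, $m(r)=\lceil\frac{r+1}2\rceil$. An $r$-graph is a pair $R=(V,c)$ with $c:\binom V2\to2^{[r]}$; it is complete if $c(e)\neq\emptyset$ for all $e$. A violating triple is $(i,j,k)\in\mathbb N^3$ for which $|i-j|\leq k\leq i+j$ fails. $\tilde M_r(t)$ is the set of $r$-graphs $([t],c)$ with no pairwise distinct $x,y,z$ and violating triple $(i,j,k)$ such that $i\in c(xy)$, $j\in c(yz)$, $k\in c(xz)$. For $ij\in\binom{[t]}2$, $f^R(i,j)=\max\{|c(ij)|,1\}$ and $W(R)=\prod_{ij}f^R(i,j)$. $\tilde C_r(t)$ is the set of complete $r$-graphs $R=([t],c)$ such that: if $r$ is even, $c(xy)=[\frac r2,r]$ for all $xy$; if $r$ is odd, there is a partition $[t]=V_1\cup\cdots\cup V_s$ with $c(xy)=[\frac{r-1}2,r-1]$ when $x,y$ lie in a common part and $c(xy)=[\frac{r+1}2,r]$ when they lie in different parts. Two $r$-graphs $(V,c),(V,c')$ are $\delta$-close if $|\{e\in\binom V2:c(e)\neq c'(e)\}|\leq\delta|V|^2$. *)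

(* Defs.v *)
From mathcomp Require Import all_boot all_order all_algebra.
From mathcomp Require Import reals.

Set Implicit Arguments.
Unset Strict Implicit.
Unset Printing Implicit Defensive.

Import Order.TTheory GRing.Theory Num.Theory.

Section RGraphs.

Variables (V : finType) (r : nat).

Definition edge := {e : {set V} | #|e| == 2}.

(* The palette {1, ..., r} is encoded by 'I_r, with i : 'I_r standing for the
   colour i.+1. *)
Definition r_graph := {ffun edge -> {set 'I_r}}.

(* The colour set of the pair xy; set0 is a junk value when x = y. *)
Definition colours (R : r_graph) (x y : V) : {set 'I_r} :=
  if insub [set x; y] is Some e then R e else set0.

Definition complete_r_graph (R : r_graph) : Prop := forall e : edge, R e != set0.

Definition colour_itv (a b : nat) : {set 'I_r} := [set i : 'I_r | a <= i.+1 <= b].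

Definition edge_weight (R : r_graph) (e : edge) : nat := maxn #|R e| 1.

Definition weight (R : r_graph) : nat := \prod_(e : edge) edge_weight R e.

Definition delta_close (K : realType) (delta : K) (R R' : r_graph) : Prop :=
  (#|[set e : edge | R e != R' e]|%:R <= delta * #|V|%:R ^+ 2)%R.

End RGraphs.

Definition violating (i j k : nat) : bool := ~~ (`|i - j|%N <= k <= i + j).

(* uphalf n is the ceiling of n / 2. *)
Definition m (r : nat) : nat := uphalf r.+1.

Definition Mtilde (r t : nat) (R : r_graph 'I_t r) : Prop :=
  ~ exists x y z : 'I_t, exists i j k : 'I_r,
      [/\ [/\ x != y, y != z & x != z],
          violating i.+1 j.+1 k.+1 &
          [/\ i \in colours R x y, j \in colours R y z & k \in colours R x z]].

Definition Ctilde (r t : nat) (R : r_graph 'I_t r) : Prop :=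
  complete_r_graph R /\
  if odd r then
    exists P : {set {set 'I_t}}, partition P [set: 'I_t] /\
      forall e : edge 'I_t,
        R e = if [exists B in P, val e \subset B]
              then colour_itv r r.-1./2 r.-1
              else colour_itv r r.+1./2 r
  else forall e : edge 'I_t, R e = colour_itv r r./2 r.

(* Main.v *)
(* Write g(e) = max(|c(e)|, 1). The triangle inequality forces
   g(vy) + g(uy) <= 2m whenever |c(uv)|, |c(uy)| > m, so two adjacent edges
   heavier than m close up with a light edge whose logarithmic loss strictly
   dominates the gain of either heavy edge. Deleting vertices of minimum weighted
   degree shows that, up to O(t), the total gain is paid for by the losses with a
   definite surplus per edge having g(e) <> m; hence W(R) > m^((1-eps) C(t,2))
   leaves only few such edges. Two adjacent edges of size m with a third edge of
   size m cannot both have palettes other than the extremal ones, so the same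
   deletion argument bounds the nonextremal edges. For r odd, the pairs with the
   lower palette then form a relation that is transitive up to nonextremal pairs,
   and pivot clustering turns it into an equivalence at linear cost. *)

Require Import Defs.
From mathcomp Require Import all_boot all_order all_algebra.
From mathcomp Require Import reals exp.
From mathcomp Require Import zify ring lra.

Set Implicit Arguments.
Unset Strict Implicit.
Unset Printing Implicit Defensive.

Import Order.TTheory GRing.Theory Num.Theory.

Local Open Scope ring_scope.

(** * Palettes on the three sides of a triangle *)

Definition metric_triple r (A B C : {set 'I_r}) : Prop :=
  forall i j k, i \in A -> j \in B -> k \in C -> ~~ violating i.+1 j.+1 k.+1.

Lemma card_colour_itv r a b : (#|colour_itv r a b| <= b.+1 - a)%N.
Proof.
rewrite cardE -(size_map (fun i : 'I_r => i.+1)) -(size_iota a (b.+1 - a)).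
apply: uniq_leq_size.
  by rewrite map_inj_uniq ?enum_uniq // => i j [] /val_inj.
move=> k /mapP[i]; rewrite mem_enum inE => hi ->.
by rewrite mem_iota; lia.
Qed.

Lemma colour_set_span r (A : {set 'I_r}) : A != set0 ->
  exists i j : 'I_r, [/\ i \in A, j \in A & A \subset colour_itv r i.+1 j.+1].
Proof.
case/set0Pn=> x xA.
case: (arg_minnP (fun i : 'I_r => i : nat) xA) => i iA hi.
case: (arg_maxnP (fun i : 'I_r => i : nat) xA) => j jA hj.
exists i, j; split=> //; apply/subsetP=> k kA; rewrite inE.
by move: (hi k kA) (hj k kA); lia.
Qed.

(** Only extreme colours matter: the largest colour of one palette is tested against the smallest
    colours of the other two. This trades three sets for six integers, so that later arguments
    become linear arithmetic. *)
Lemma metric_triple_span r (A B C : {set 'I_r}) : metric_triple A B C ->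
  A != set0 -> B != set0 -> C != set0 ->
  exists a a' b b' c c',
  [/\ [/\ A \subset colour_itv r a a', B \subset colour_itv r b b' &
          C \subset colour_itv r c c'],
      [/\ #|A| <= a'.+1 - a, #|B| <= b'.+1 - b & #|C| <= c'.+1 - c]%N,
      [/\ a' <= b + c, b' <= a + c & c' <= a + b]%N &
      [/\ a' <= r, b' <= r & c' <= r]%N].
Proof.
move=> hABC /colour_set_span[a [a' [aA a'A sA]]].
move=> /colour_set_span[b [b' [bB b'B sB]]] /colour_set_span[c [c' [cC c'C sC]]].
exists a.+1, a'.+1, b.+1, b'.+1, c.+1, c'.+1; split; split=> //.
- by rewrite (leq_trans (subset_leq_card sA)) ?card_colour_itv.
- by rewrite (leq_trans (subset_leq_card sB)) ?card_colour_itv.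
- by rewrite (leq_trans (subset_leq_card sC)) ?card_colour_itv.
- by move: (hABC _ _ _ a'A bB cC); rewrite /violating; lia.
- by move: (hABC _ _ _ aA b'B cC); rewrite /violating; lia.
- by move: (hABC _ _ _ aA bB c'C); rewrite /violating; lia.
Qed.

(** With the spans as above, adding [b' <= a + c] and [c' <= a + b] gives |B| + |C| <= 2a + 2, while
    |A| > m forces a <= r - m; then r + 1 <= 2m concludes. For empty [C] the bound |B| <= r
    suffices. *)
Lemma metric_triple_card r (A B C : {set 'I_r}) : (3 <= r)%N ->
  metric_triple A B C -> (m r < #|A|)%N -> (m r < #|B|)%N ->
  (maxn #|C| 1 + #|B| <= 2 * m r)%N.
Proof.
move=> hr hABC hA hB; have hBr : (#|B| <= r)%N by rewrite -[leqRHS]card_ord max_card.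
have hm : (2 * m r = r.+1)%N \/ (2 * m r = r.+2)%N by rewrite /m; lia.
move: (m r) hm hA hB => q hm hA hB.
have [->|C0] := eqVneq C set0; first by rewrite cards0; lia.
have A0 : A != set0 by rewrite -card_gt0; lia.
have B0 : B != set0 by rewrite -card_gt0; lia.
have [a [a' [b [b' [c [c' [_ [? ? ?] [? ? ?] [? ? ?]]]]]]]] :=
  metric_triple_span hABC A0 B0 C0.
by rewrite -card_gt0 in C0; lia.
Qed.

(** Floor division turns [r.+1./2] into r/2 for even r and (r+1)/2 for odd r, so these are exactly
    the palettes occurring in [Ctilde]. *)
Definition high_palette r : {set 'I_r} := colour_itv r r.+1./2 r.
Definition low_palette r : {set 'I_r} :=
  if odd r then colour_itv r r.-1./2 r.-1 else high_palette r.
Definition extremal r (A : {set 'I_r}) : bool :=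
  (A == high_palette r) || (A == low_palette r).

(** As before 2m <= 2a + 2, and likewise for b, so both palettes start at m - 1 or later. A palette
    of size m starting at [r.+1./2] or later must be the high one; for even r this is the only case.
    For odd r it remains that a = b = (r-1)/2. Then c' <= r - 1, hence c <= (r-1)/2 and a' <= b + c
    <= r - 1, so [A] is the low palette. *)
Lemma metric_triple_extremal r (A B C : {set 'I_r}) : (3 <= r)%N ->
  metric_triple A B C -> #|A| = m r -> #|B| = m r -> #|C| = m r ->
  extremal A || extremal B.
Proof.
move=> hr hABC hA hB hC; have hm : (m r = (r + ~~ odd r).+1./2)%N.
  by rewrite /m; move: (odd_double_half r); case: (odd r); lia.
have m0 : (0 < m r)%N by rewrite hm; lia.
have A0 : A != set0 by rewrite -card_gt0 hA.
have B0 : B != set0 by rewrite -card_gt0 hB.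
have C0 : C != set0 by rewrite -card_gt0 hC.
have [a [a' [b [b' [c [c' [[sA sB sC] [? ? ?] [? ? ?] [? ? ?]]]]]]]] :=
  metric_triple_span hABC A0 B0 C0.
have itvE (D : {set 'I_r}) d d' p q : D \subset colour_itv r d d' ->
  #|D| = m r -> (p <= d)%N -> (d' <= q)%N -> (q.+1 - p <= m r)%N ->
  D = colour_itv r p q.
  move=> sD hD hp hq hpq; apply/eqP; rewrite eqEcard; apply/andP; split.
    by apply: subset_trans sD _; apply/subsetP=> i; rewrite !inE; lia.
  by rewrite hD (leq_trans (card_colour_itv _ _ _)).
rewrite /extremal /low_palette; case: ifP => hodd; rewrite hodd in hm.
  have {}hm : m r = r.+1./2 by rewrite hm; lia.
  have [ha|ha] := leqP r.+1./2 a.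
    by rewrite /high_palette -(itvE A a a') ?eqxx //; lia.
  have [hb|hb] := leqP r.+1./2 b.
    by rewrite /high_palette -(itvE B b b') ?eqxx ?orbT //; lia.
  by rewrite -(itvE A a a' r.-1./2 r.-1) ?eqxx ?orbT //; lia.
have {}hm : m r = r.+2./2 by rewrite hm; lia.
have [ha|ha] := leqP r.+1./2 a.
  by rewrite /high_palette -(itvE A a a') ?eqxx //; lia.
by rewrite /high_palette -(itvE B b b') ?eqxx ?orbT //; lia.
Qed.

(** The colours (r-1)/2, (r-1)/2 and r are a violating choice, since the first two sum to r - 1. As
    ordinals they are stored one lower. *)
Lemma low_low_high_violating r : (3 <= r)%N -> odd r ->
  ~ metric_triple (low_palette r) (low_palette r) (high_palette r).
Proof.
move=> hr hodd; rewrite /low_palette hodd => h.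
have p1 : (r.-1./2.-1 < r)%N by lia.
have p2 : (r.-1 < r)%N by lia.
have := h (Ordinal p1) (Ordinal p1) (Ordinal p2).
by rewrite !inE /violating /=; lia.
Qed.

(** * Averaging and weighted cherries *)

Lemma exists_in_sum_le (T : finType) (S : {set T}) (F G : T -> nat) : S != set0 ->
  (\sum_(v in S) F v <= \sum_(v in S) G v)%N ->
  exists2 v, v \in S & (F v <= G v)%N.
Proof.
move=> S0 hFG; case: (boolP [exists v in S, (F v <= G v)%N]).
  by case/exists_inP=> v vS hv; exists v.
rewrite negb_exists_in => /forall_inP hlt.
suff : (\sum_(v in S) G v + #|S| <= \sum_(v in S) F v)%N.
  by move: S0; rewrite -card_gt0; lia.
rewrite -sum1_card -big_split /=; apply: leq_sum => v vS.
by rewrite addn1 ltnNge hlt.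
Qed.

Section WeightedCherries.

(** Here [h] is the gain of a heavy pair and [l] the loss of a light one. By [cherry], the pair
    closing a path v, u, y of gaining pairs pays for the gain of uy. *)
Variables (T : finType) (K : realDomainType) (h l : T -> T -> K) (C : K).
Hypotheses (h_sym : forall x y, h x y = h y x) (l_sym : forall x y, l x y = l y x).
Hypotheses (h_irr : forall x, h x x = 0).
Hypotheses (h_ge0 : forall x y, 0 <= h x y) (l_ge0 : forall x y, 0 <= l x y).
Hypothesis h_le : forall x y, h x y <= C.
Hypothesis cherry : forall u v y,
  y != v -> 0 < h u v -> 0 < h u y -> h u y <= l v y.

Lemma sum_pairs_setD1 (F : T -> T -> K) (S : {set T}) v :
  (forall x y, F x y = F y x) -> v \in S ->
  \sum_(x in S) \sum_(y in S) F x y =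
  F v v + (\sum_(y in S :\ v) F v y) *+ 2
    + \sum_(x in S :\ v) \sum_(y in S :\ v) F x y.
Proof.
move=> F_sym vS; rewrite (big_setD1 v) //= (big_setD1 v) //= mulr2n -!addrA.
congr (_ + (_ + _)); rewrite -big_split /=; apply: eq_bigr => x _.
by rewrite (big_setD1 v) //= F_sym.
Qed.

(* Delete a vertex [v] of minimum weighted degree: if [u] is a neighbour of [v],
   then the other neighbours of [u] carry weight at least [deg v - C], and each
   of them closes a cherry with [v]. *)
Lemma weighted_cherry_bound (S : {set T}) :
  \sum_(x in S) \sum_(y in S) h x y <=
  \sum_(x in S) \sum_(y in S) l x y + C *+ 2 *+ #|S|.
Proof.
have [n] := ubnP #|S|; elim: n S => // n IHn S hS.
have [->|[w wS]] := set_0Vmem S; first by rewrite !big_set0 cards0 addr0.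
pose D v := \sum_(y in S) h v y.
case: (@arg_minP _ _ _ w (fun x => x \in S) D wS) => v vS minD.
have C_ge0 : 0 <= C by apply: le_trans (h_le v v); rewrite h_ge0.
have hv : \sum_(y in S :\ v) h v y <= \sum_(y in S :\ v) l v y + C.
  have Dv : D v = \sum_(y in S :\ v) h v y.
    by rewrite /D (big_setD1 v) //= h_irr add0r.
  case: (boolP [exists u in S, 0 < h v u]); last first.
    rewrite negb_exists_in => /forall_inP hn.
    rewrite big1 ?addr_ge0 ?sumr_ge0 // => y; rewrite in_setD1 => /andP[_ yS].
    by apply/le_anti; rewrite h_ge0 andbT leNgt hn.
  case/exists_inP=> u uS hvu; rewrite -Dv (le_trans (minD u uS)) //.
  rewrite /D (big_setD1 v) //= addrC lerD ?h_le //; apply: ler_sum => y.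
  rewrite in_setD1 => /andP[yv yS].
  have := h_ge0 u y; rewrite le_eqVlt => /predU1P[<- //|huy].
  by apply: cherry => //; rewrite h_sym.
(* Ordered pairs count the row of [v] twice, hence the charge [C *+ 2] for each deleted vertex. *)
rewrite !(sum_pairs_setD1 _ vS) // h_irr add0r.
have /IHn : (#|S :\ v| < n)%N by move: hS; rewrite (cardsD1 v S) vS.
have := l_ge0 v v; rewrite (cardsD1 v S) vS add1n [C *+ 2 *+ _.+1]mulrS.
move: hv; set hv := \sum_(y in _) h v y; set lv := \sum_(y in _) l v y.
set hS' := \sum_(x in _) _; set lS' := \sum_(x in _) _; set c := C *+ 2 *+ _.
rewrite !mulr2n; clearbody hv lv hS' lS' c; lra.
Qed.

End WeightedCherries.

(** * Pivot clustering of a nearly transitive relation *)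

Section PivotClustering.

Variables (T : finType) (L B : rel T).
Hypothesis L_sym : symmetric L.
Hypothesis L_trans : forall x y z, x != z -> L x y -> L y z -> L x z || B x z.

(* Exchanging the roles of the pivot [v] and of [x] turns one count into the
   other. *)
Lemma exists_pivot (S : {set T}) : S != set0 -> exists2 v, v \in S &
  (\sum_(x in S) \sum_(y in S) (L v x && L x y && B v y) <=
   \sum_(x in S) \sum_(y in S) (L v x && L v y && B x y))%N.
Proof.
move=> S0; apply: exists_in_sum_le => //.
rewrite [leqLHS]exchange_big /=; apply: leq_sum => x _; apply: leq_sum => v _.
by apply: leq_sum => y _; rewrite (L_sym v x).
Qed.

(** The pivot [v] and its [L]-neighbours form one cluster [N]; recursion treats the rest. By the
    choice of [v], the [L]-pairs leaving [N] are at most as many as the [B]-pairs inside [N]. The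
    latter are discarded with [N], so no [B]-pair is charged at two stages; the factor 2 counts both
    orders of a cut pair. *)
Lemma pivot_clustering (S : {set T}) : exists p : T -> T,
  [/\ {in S, forall x, p x \in S},
      {in S &, forall x y, x != y -> p x = p y -> L x y || B x y} &
      (\sum_(x in S) \sum_(y in S) (L x y && (p x != p y)) <=
       2 * \sum_(x in S) \sum_(y in S) B x y)%N].
Proof.
have [n] := ubnP #|S|; elim: n S => // n IHn S hS.
have [->|S0] := eqVneq S set0.
  by exists id; split=> [x|x y|]; rewrite ?inE // !big_set0.
have [v vS hv] := exists_pivot S0.
pose N := [set x | (x == v) || L v x].
have vN : v \in N by rewrite inE eqxx.
have [|p [pS pLB pE]] := IHn (S :\: N).
  have : (0 < #|S :&: N|)%N.
    by rewrite card_gt0; apply/set0Pn; exists v; rewrite inE vS.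
  by move: hS; rewrite -(cardsID N S); lia.
have pN x : x \in S -> x \notin N -> p x \notin N.
  by move=> xS xN; have := pS x; rewrite !in_setD xS xN => /(_ isT)/andP[].
exists (fun x => if x \in N then v else p x); split=> [x xS|x y xS yS xy|].
- by case: ifPn => // xN; have := pS x; rewrite !in_setD xS xN => /(_ isT)/andP[].
- case: ifPn => xN; case: ifPn => yN pxy.
  + move: xN yN; rewrite !inE => /predU1P[xv|vx] /predU1P[yv|vy].
    * by rewrite xv yv eqxx in xy.
    * by rewrite xv vy.
    * by rewrite yv L_sym vx.
    * by apply: L_trans vy; rewrite // L_sym.
  + by have := pN y yS yN; rewrite -pxy vN.
  + by have := pN x xS xN; rewrite pxy vN.
  + by apply: pLB; rewrite ?in_setD ?xN ?yN.
have splitS (F : T -> T -> nat) : \sum_(x in S) \sum_(y in S) F x y =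
    (\sum_(x in S :&: N) \sum_(y in S :&: N) F x y +
     \sum_(x in S :&: N) \sum_(y in S :\: N) F x y +
     (\sum_(x in S :\: N) \sum_(y in S :&: N) F x y +
      \sum_(x in S :\: N) \sum_(y in S :\: N) F x y))%N.
  rewrite (big_setID N) /= -!big_split /=.
  by congr addn; apply: eq_bigr => x _; rewrite (big_setID N).
pose q x := if x \in N then v else p x.
have cross : (\sum_(x in S :&: N) \sum_(y in S :\: N) (L x y && (q x != q y)) <=
    \sum_(x in S :&: N) \sum_(y in S :&: N) B x y)%N.
  apply: (@leq_trans (\sum_(x in S) \sum_(y in S) (L v x && L x y && B v y))).
    rewrite [leqRHS](big_setID N) /= (leq_trans _ (leq_addr _ _)) //.
    apply: leq_sum => x; rewrite !inE => /andP[xS xN].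
    rewrite [leqRHS](big_setID N) /= (leq_trans _ (leq_addl _ _)) //.
    apply: leq_sum => y; rewrite !inE negb_or => /andP[/andP[yv nvy] yS].
    case: (boolP (L x y)) => //= xy; case/predU1P: xN => [xv|vx].
      by rewrite -xv xy in nvy.
    (* Since [y] lies outside [N], near-transitivity along [v], [x], [y] leaves only [B v y]. *)
    have := L_trans _ vx xy; rewrite eq_sym yv (negPf nvy) => /(_ isT) /= ->.
    by rewrite vx; case: (_ != _).
  apply: leq_trans hv _.
  have sub2 (F : T -> nat) (G : T -> nat) :
      (forall x, x \in S -> F x <= if x \in N then G x else 0)%N ->
      (\sum_(x in S) F x <= \sum_(x in S :&: N) G x)%N.
    move=> hFG; rewrite (big_setID N) /= [X in (_ + X)%N]big1 ?addn0.
      apply: leq_sum => x; rewrite inE => /andP[xS xN].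
      by have := hFG x xS; rewrite xN.
    move=> x; rewrite inE => /andP[xN xS]; apply/eqP.
    by rewrite -leqn0; have := hFG x xS; rewrite (negPf xN).
  apply: (sub2) => x xS; case: ifPn => xN.
    apply: (sub2) => y yS; case: ifPn => yN; first by case: (L v x) (L v y) => [] [].
    by move: yN; rewrite inE negb_or => /andP[_ /negPf->]; rewrite andbF.
  rewrite big1 // => y _.
  by move: xN; rewrite inE negb_or => /andP[_ /negPf->].
rewrite -/q !splitS.
have -> : (\sum_(x in S :&: N) \sum_(y in S :&: N) (L x y && (q x != q y)) = 0)%N.
  apply: big1 => x; rewrite in_setI => /andP[_ xN]; apply: big1 => y.
  by rewrite in_setI /q xN => /andP[_ ->]; rewrite eqxx andbF.
have -> : (\sum_(x in S :\: N) \sum_(y in S :&: N) (L x y && (q x != q y)) =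
    \sum_(x in S :&: N) \sum_(y in S :\: N) (L x y && (q x != q y)))%N.
  rewrite exchange_big /=; apply: eq_bigr => x _; apply: eq_bigr => y _.
  by rewrite L_sym eq_sym.
have -> : (\sum_(x in S :\: N) \sum_(y in S :\: N) (L x y && (q x != q y)) =
    \sum_(x in S :\: N) \sum_(y in S :\: N) (L x y && (p x != p y)))%N.
  apply: eq_bigr => x; rewrite in_setD => /andP[/negPf xN _].
  apply: eq_bigr => y; rewrite in_setD => /andP[/negPf yN _].
  by rewrite /q xN yN.
move: cross pE; set X := (\sum_(x in S :&: N) \sum_(y in S :\: N) _)%N.
set P := (\sum_(x in S :\: N) _)%N; set B1 := (\sum_(x in S :&: N) _)%N.
set B4 := (\sum_(x in S :\: N) _)%N; clearbody X P B1 B4 => hX hP.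
by rewrite (leq_trans (leq_add hX (leq_add hX hP))) //; lia.
Qed.

End PivotClustering.

(** * Sums over ordered pairs and sums over edges *)

Section EdgeSums.

Variables (V : finType) (M : nmodType).

Lemma sum_pairs_edge (F : {set V} -> M) :
  \sum_x \sum_(y | x != y) F [set x; y] = (\sum_(e : edge V) F (val e)) *+ 2.
Proof.
rewrite pair_big_dep /=.
rewrite (partition_big (fun p : V * V => [set p.1; p.2])
          (fun A : {set V} => #|A| == 2)) /=; last first.
  by move=> p hp; rewrite cards2 hp.
have <- : \sum_(A : {set V} | #|A| == 2) F A = \sum_(e : edge V) F (val e).
  exact: (big_sub [pred A : {set V} | #|A| == 2]).
rewrite -sumrMnl; apply: eq_bigr => A /cards2P[a [b [ab ->]]].
rewrite (eq_bigr (fun=> F [set a; b])) => [|p /andP[_ /eqP->] //].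
rewrite sumr_const; congr (_ *+ _).
have ab_ba : (a, b) != (b, a) by apply: contraNneq ab => -[->].
(* Writing 2 as [((a, b) != (b, a)).+1] lets [cards2] fold it into the size of the fibre {(a, b),
   (b, a)}. *)
rewrite -[RHS]/(true.+1) -ab_ba -cards2; apply: eq_card => -[x y].
rewrite !inE !xpair_eqE /=; apply/andP/orP => [[xy /eqP/setP eAB]|].
  have := eAB a; have := eAB b; rewrite !inE !eqxx orbT /=.
  case/orP=> /eqP eb /orP[] /eqP ea.
  - by rewrite ea eb eqxx in ab.
  - by right; rewrite ea eb !eqxx.
  - by left; rewrite ea eb !eqxx.
  - by rewrite ea eb eqxx in ab.
case=> /andP[/eqP-> /eqP->]; first by rewrite ab.
by rewrite eq_sym ab setUC.
Qed.

End EdgeSums.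

Lemma coloursC (V : finType) r (R : r_graph V r) x y : colours R x y = colours R y x.
Proof. by rewrite /colours setUC. Qed.

Lemma colours_edge (V : finType) r (R : r_graph V r) (e : edge V) x y :
  val e = [set x; y] -> colours R x y = R e.
Proof. by rewrite /colours => <-; rewrite valK. Qed.

(** Translates the pair sums of the cherry bound into edge sums; the guard [x != y] hides the junk
    value of [colours] on the diagonal. *)
Lemma sum_colours (V : finType) r (R : r_graph V r) (M : nmodType)
    (F : {set 'I_r} -> M) :
  \sum_(x in [set: V]) \sum_(y in [set: V])
     (if x != y then F (colours R x y) else 0) =
  (\sum_(e : edge V) F (R e)) *+ 2.
Proof.
pose G A := F (if insub A is Some e then R e else set0 : {set 'I_r}).
have sumT (f : V -> M) : \sum_(x in [set: V]) f x = \sum_x f x.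
  by apply: eq_bigl => x; rewrite inE.
rewrite sumT (eq_bigr (fun x => \sum_(y | x != y) G [set x; y])) => [|x _].
  rewrite sum_pairs_edge; congr (_ *+ _).
  by apply: eq_bigr => e _; rewrite /G valK.
by rewrite sumT -big_mkcond.
Qed.

Lemma card_edge (V : finType) : #|{: edge V}| = 'C(#|V|, 2).
Proof. by rewrite -card_draws card_sig; apply: eq_card => A; rewrite !inE. Qed.

Lemma Mtilde_metric r t (R : r_graph 'I_t r) x y z : Mtilde R ->
  x != y -> y != z -> x != z ->
  metric_triple (colours R x y) (colours R y z) (colours R x z).
Proof.
move=> hR xy yz xz i j k hi hj hk; apply/negP=> hv; apply: hR.
by exists x, y, z, i, j, k.
Qed.

(** * Logarithmic weights and irregular edges *)

(** By integrality, p < q gives pq <= q^2 - 1, and p + s <= 2q with s > q gives ps <= q^2 - (s -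
    q)^2 <= q^2 - 1. Either way the logarithms fall short of 2 ln q by at least [d]; taking kap =
    d/2 leaves one [kap] for the heavy edge and one for the light edge. *)
Lemma log_deficit (K : realType) q : (2 <= q)%N ->
  exists2 kap : K, 0 < kap &
  forall p, (0 < p)%N ->
    ((p < q)%N -> kap <= ln q%:R - ln p%:R) /\
    (forall s, (q < s)%N -> (p + s <= 2 * q)%N ->
       ln s%:R - ln q%:R + kap <= ln q%:R - ln p%:R - kap).
Proof.
move=> hq; pose d : K := ln (q ^ 2)%:R - ln (q ^ 2 - 1)%:R.
have pos n : (0 < n)%N -> (n%:R : K) \is Num.pos by rewrite posrE ltr0n.
have q2 : (0 < q ^ 2 - 1)%N by nia.
have q0 : (0 < q)%N by lia.
have d0 : 0 < d by rewrite subr_gt0 ltr_ln ?pos ?ltr_nat //; lia.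
have lnq2 : ln (q ^ 2)%:R = ln q%:R + ln q%:R :> K.
  by rewrite -mulnn natrM lnM ?pos.
have lnle n k : (0 < n)%N -> (0 < k)%N -> (n * k <= q ^ 2 - 1)%N ->
    ln n%:R + ln k%:R + d <= ln q%:R + ln q%:R :> K.
  move=> n0 k0 hnk; rewrite -lnM ?pos // -natrM -lnq2 /d.
  have : ln (n * k)%:R <= ln (q ^ 2 - 1)%:R :> K.
    by rewrite ler_ln ?pos ?ler_nat // muln_gt0 n0.
  lra.
exists (d / 2); first by rewrite divr_gt0.
move=> p p0; split=> [pq|s qs ps].
  by have := lnle p q p0 q0 ltac:(nia); lra.
by have := lnle p s p0 ltac:(lia) ltac:(nia); lra.
Qed.

Lemma m_gt1 r : (3 <= r)%N -> (2 <= m r)%N.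
Proof. by rewrite /m; lia. Qed.

Lemma bin2_le_sqr n : ('C(n, 2) <= n ^ 2)%N.
Proof. by rewrite bin2 -mulnn; have := leq_mul (leqnn n) (leq_pred n); lia. Qed.

Definition irregular_edges (V : finType) r (R : r_graph V r) : {set edge V} :=
  [set e | edge_weight R e != m r].
Definition nonextremal_edges (V : finType) r (R : r_graph V r) : {set edge V} :=
  [set e | ~~ extremal (R e)].

Lemma ln_prod_nat (K : realType) (I : finType) (F : I -> nat) :
  (forall i, 0 < F i)%N -> ln (\prod_i F i)%N%:R = \sum_i ln (F i)%:R :> K.
Proof.
(* Positivity travels with the identity because [lnM] needs both factors positive. *)
move=> F0; pose Q (n : nat) (x : K) := (0 < n)%N /\ ln n%:R = x.
suff [] : Q (\prod_i F i)%N (\sum_i ln (F i)%:R) by [].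
apply: (big_rec2 Q) => [|i n x _ [x0 hx]]; first by split; rewrite ?ln1.
split; first by rewrite muln_gt0 F0 x0.
by rewrite natrM lnM ?posrE ?ltr0n ?F0 ?x0 // hx.
Qed.

Lemma card_set_sum (K : pzSemiRingType) (I : finType) (P : pred I) :
  #|[set i | P i]|%:R = \sum_i (P i)%:R :> K.
Proof.
rewrite -sum1_card natr_sum big_mkcond /=; apply: eq_bigr => i _.
by rewrite inE; case: (P i).
Qed.

(** Gains are raised and losses lowered by [kap], so that on every edge [hF - lF] equals [w] plus
    [kap] if the edge is irregular. The cherry bound still applies, by [metric_triple_card] and the
    surplus in [log_deficit], and the [w] add up to ln W - C(t,2) ln m. *)
Lemma irregular_edges_bound (K : realType) r : (3 <= r)%N ->
  exists kap C : K, [/\ 0 < kap, 0 <= C & forall t (R : r_graph 'I_t r), Mtilde R ->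
    kap * #|irregular_edges R|%:R <=
    C * t%:R + ln (m r)%:R * 'C(t, 2)%:R - ln (weight R)%:R].
Proof.
move=> hr; have m2 := m_gt1 hr; have [kap kap0 hkap] := log_deficit K m2.
have ln_ge0n n : 0 <= ln n%:R :> K.
  by case: n => [|n]; [rewrite ln0 | rewrite ln_ge0 // ler1n].
(* This constant bounds the gain of a single edge, as g <= r and ln m >= 0. *)
exists kap, (ln r%:R + kap); split=> //; first by rewrite addr_ge0 // ltW.
move=> t R hR; set C := _ + kap.
pose g (A : {set 'I_r}) := maxn #|A| 1.
pose w A : K := ln (g A)%:R - ln (m r)%:R.
pose hF A := if (m r < g A)%N then w A + kap else 0.
pose lF A := if (g A < m r)%N then - w A - kap else 0.
have g0 A : (0 < g A)%N by rewrite /g; lia.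
have hF0 A : 0 <= hF A.
  rewrite /hF; case: ifP => // hA.
  by rewrite addr_ge0 ?ltW // subr_gt0 ltr_ln ?posrE ?ltr0n ?ltr_nat //; lia.
have lF0 A : 0 <= lF A.
  rewrite /lF; case: ifP => // hA; have [/(_ hA)] := hkap (g A) (g0 A).
  by rewrite /w; lra.
have hFgt A : 0 < hF A -> (m r < #|A|)%N.
  by rewrite /hF; case: ifP; rewrite ?ltxx // /g; lia.
pose h x y := if x != y then hF (colours R x y) else 0.
pose l x y := if x != y then lF (colours R x y) else 0.
have main : \sum_(x in [set: 'I_t]) \sum_(y in [set: 'I_t]) h x y <=
    \sum_(x in [set: 'I_t]) \sum_(y in [set: 'I_t]) l x y + C *+ 2 *+ #|[set: 'I_t]|.
  apply: weighted_cherry_bound; rewrite /h /l.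
  - by move=> x y; rewrite eq_sym coloursC.
  - by move=> x y; rewrite eq_sym coloursC.
  - by move=> x; rewrite eqxx.
  - by move=> x y; case: ifP.
  - by move=> x y; case: ifP.
  - move=> x y; have C0 : 0 <= C by rewrite addr_ge0 // ltW.
    case: ifP => // _; rewrite /hF; case: ifP => // _; rewrite lerD2r /w.
    have : ln (g (colours R x y))%:R <= ln r%:R :> K.
      rewrite ler_ln ?posrE ?ltr0n ?ler_nat ?g0 //; last by lia.
      by rewrite /g geq_max (leq_trans (max_card _)) ?card_ord //; lia.
    by have := ln_ge0n (m r); lra.
  - move=> u v y yv; rewrite (eq_sym v) yv.
    case: ifP => [uv|]; last by rewrite ltxx.
    case: ifP => [uy|]; last by rewrite ltxx.
    move=> /hFgt huv hFuy; have huy := hFgt _ hFuy.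
    rewrite coloursC in huv.
    have := metric_triple_card hr (Mtilde_metric hR _ uy _) huv huy.
    rewrite eq_sym uv eq_sym yv => /(_ isT isT); rewrite -/(g _) => hg.
    rewrite /hF /lF /w; have -> : (m r < g (colours R u y))%N by rewrite /g; lia.
    have -> : (g (colours R v y) < m r)%N by lia.
    have [_ /(_ (g (colours R u y)))] := hkap _ (g0 (colours R v y)).
    by rewrite /g in hg *; move=> /(_ ltac:(lia) ltac:(lia)); lra.
have {}main : \sum_(e : edge 'I_t) (hF (R e) - lF (R e)) <= C * t%:R.
  move: main; rewrite !sum_colours cardsT card_ord -mulrnA mulnC mulrnA -mulrnDl.
  by rewrite lerMn2r /= sumrB lerBlDl mulr_natr.
have lnW : ln (weight R)%:R = \sum_(e : edge 'I_t) ln (g (R e))%:R :> K.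
  by rewrite /weight ln_prod_nat // => e; exact: g0.
have sumE : \sum_(e : edge 'I_t) (hF (R e) - lF (R e)) =
    ln (weight R)%:R - ln (m r)%:R * 'C(t, 2)%:R + kap * #|irregular_edges R|%:R.
  have -> : 'C(t, 2) = #|{: edge 'I_t}| by rewrite card_edge card_ord.
  rewrite lnW card_set_sum -sum1_card natr_sum !mulr_sumr.
  rewrite -sumrB -big_split /=; apply: eq_bigr => e _.
  rewrite /edge_weight -/(g _) /hF /lF /w mulr1.
  by case: (ltngtP (m r) (g (R e))) => [_|_|<-] /=; lra.
by move: main; rewrite sumE; lra.
Qed.

(** * Counting nonextremal edges *)

(** The cherry bound with 0/1 weights: [hF] marks nonextremal palettes of size m, [lF] irregular
    edges. Two adjacent marked edges force the third to be irregular by [metric_triple_extremal].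
    Nonextremal edges not marked by [hF] are irregular, whence the factor 2. *)
Lemma nonextremal_edges_bound r t (R : r_graph 'I_t r) : (3 <= r)%N -> Mtilde R ->
  (#|nonextremal_edges R| <= 2 * #|irregular_edges R| + t)%N.
Proof.
move=> hr hR; have m2 := m_gt1 hr; pose g (A : {set 'I_r}) := maxn #|A| 1.
pose hF A : int := (~~ extremal A && (g A == m r))%:R.
pose lF A : int := (g A != m r)%:R.
pose h x y := if x != y then hF (colours R x y) else 0.
pose l x y := if x != y then lF (colours R x y) else 0.
have main : \sum_(x in [set: 'I_t]) \sum_(y in [set: 'I_t]) h x y <=
    \sum_(x in [set: 'I_t]) \sum_(y in [set: 'I_t]) l x y + 1 *+ 2 *+ #|[set: 'I_t]|.
  apply: weighted_cherry_bound; rewrite /h /l.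
  - by move=> x y; rewrite eq_sym coloursC.
  - by move=> x y; rewrite eq_sym coloursC.
  - by move=> x; rewrite eqxx.
  - by move=> x y; case: ifP; rewrite // ler0n.
  - by move=> x y; case: ifP; rewrite // ler0n.
  - by move=> x y; case: ifP; rewrite // /hF; case: (_ && _).
  - move=> u v y yv; rewrite (eq_sym v) yv.
    case: ifP => [uv|]; last by rewrite ltxx.
    case: ifP => [uy|]; last by rewrite ltxx.
    rewrite /hF /lF; case: andP => [[/negP nuv guv] _|]; last by rewrite ltxx.
    case: andP => [[/negP nuy guy] _|]; last by rewrite ltxx.
    case: (eqVneq (g (colours R v y)) (m r)) => // gvy.
    have gE A : g A = m r -> #|A| = m r by rewrite /g; lia.
    have vu : v != u by rewrite eq_sym uv.
    have vy : v != y by rewrite eq_sym.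
    have := metric_triple_extremal hr (Mtilde_metric hR vu uy vy).
    rewrite coloursC !gE ?(eqP guv) ?(eqP guy) // => /(_ erefl erefl erefl).
    by case/orP.
have {}main : \sum_(e : edge 'I_t) hF (R e) <= \sum_(e : edge 'I_t) lF (R e) + t%:R.
  move: main; rewrite !sum_colours cardsT card_ord -mulrnA mulnC mulrnA -mulrnDl.
  by rewrite lerMn2r.
pose X := [set e : edge 'I_t | ~~ extremal (R e) && (g (R e) == m r)].
have hX : (#|X| <= #|irregular_edges R| + t)%N.
  by rewrite -(ler_nat int) natrD !card_set_sum; exact: main.
have /subset_leq_card : nonextremal_edges R \subset irregular_edges R :|: X.
  apply/subsetP=> e; rewrite !inE => ->.
  by rewrite /edge_weight -/(g _); case: eqP.
rewrite cardsU => hU; apply: (leq_trans hU).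
by rewrite (leq_trans (leq_subr _ _)) // mul2n -addnn -addnA leq_add2l.
Qed.

(** * Approximation by a member of [Ctilde] *)

Lemma high_palette_neq0 r : (3 <= r)%N -> high_palette r != set0.
Proof.
move=> hr; have hp : (r.-1 < r)%N by lia.
by apply/set0Pn; exists (Ordinal hp); rewrite inE /=; lia.
Qed.

Lemma low_palette_neq0 r : (3 <= r)%N -> low_palette r != set0.
Proof.
move=> hr; rewrite /low_palette; case: ifP => _; last exact: high_palette_neq0.
have hp : (r.-2 < r)%N by lia.
by apply/set0Pn; exists (Ordinal hp); rewrite inE /=; lia.
Qed.

Lemma preim_partition_pair (T : finType) (p : T -> T) x y :
  [exists B in preim_partition p [set: T], [set x; y] \subset B] = (p x == p y).
Proof.
apply/exists_inP/eqP => [[B /imsetP[z _ ->]]|pxy].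
  by rewrite subUset !sub1set !inE => /andP[/eqP<- /eqP<-].
exists [set z in [set: T] | p x == p z]; first by apply/imsetP; exists x; rewrite ?inE.
by rewrite subUset !sub1set !inE pxy !eqxx.
Qed.

(** For even r every edge is recoloured with the only extremal palette. For odd r the low pairs are
    clustered: two low sides exclude a high third side, so lowness is transitive up to nonextremal
    pairs. *)
Lemma Ctilde_near r t (R : r_graph 'I_t r) : (3 <= r)%N -> Mtilde R ->
  exists R' : r_graph 'I_t r, Ctilde R' /\
    (#|[set e | R e != R' e]| <= 3 * #|nonextremal_edges R|)%N.
Proof.
move=> hr hR; case hodd : (odd r); last first.
  exists [ffun=> high_palette r]; split.
    split=> [e|]; first by rewrite ffunE high_palette_neq0.
    by rewrite hodd => e; rewrite ffunE /high_palette; congr colour_itv; lia.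
  apply: (@leq_trans #|nonextremal_edges R|); last by lia.
  apply/subset_leq_card/subsetP => e; rewrite !inE ffunE.
  by rewrite /extremal /low_palette hodd orbb.
pose L x y := (x != y) && (colours R x y == low_palette r).
pose B x y := (x != y) && ~~ extremal (colours R x y).
have L_sym : symmetric L by move=> x y; rewrite /L eq_sym coloursC.
have L_trans x y z : x != z -> L x y -> L y z -> L x z || B x z.
  move=> xz /andP[xy /eqP cxy] /andP[yz /eqP cyz]; rewrite /L /B xz /= /extremal.
  case: (eqVneq (colours R x z) (low_palette r)) => //= _; rewrite orbF.
  apply/eqP=> cxz; apply: (low_low_high_violating hr hodd).
  by have := Mtilde_metric hR xy yz xz; rewrite cxy cyz cxz.
have [p [_ pLB pE]] := pivot_clustering L_sym L_trans [set: 'I_t].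
pose P := preim_partition p [set: 'I_t].
pose joined (A : {set 'I_t}) := [exists D in P, A \subset D].
exists [ffun e => if joined (val e) then low_palette r else high_palette r]; split.
  split=> [e|].
    by rewrite ffunE; case: ifP; rewrite ?low_palette_neq0 ?high_palette_neq0.
  rewrite hodd; exists P; split; first exact: preim_partitionP.
  by move=> e; rewrite ffunE /low_palette hodd.
set D := [set e | _].
pose cross := [set e : edge 'I_t | (R e == low_palette r) && ~~ joined (val e)].
(* A changed edge inside a cluster is not low, hence nonextremal; one between clusters is
   nonextremal or low. Clustering bounds the latter by twice the nonextremal edges, for a total of
   3. *)
have sD : D \subset nonextremal_edges R :|: cross.
  apply/subsetP=> e; rewrite !inE ffunE.
  have /cards2P[x [y [xy exy]]] := valP e.
  have ce := colours_edge R exy.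
  rewrite exy /joined preim_partition_pair; case: (eqVneq (p x) (p y)) => pxy /=.
    have := pLB x y; rewrite !inE => /(_ isT isT xy pxy).
    by rewrite /L /B xy ce /= => /orP[->|->].
  by rewrite /extremal andbT => /negPf->; case: (_ == _).
have sumT (f : 'I_t -> nat) : (\sum_(x in [set: 'I_t]) f x = \sum_x f x)%N.
  by apply: eq_bigl => x; rewrite inE.
have crossE : (#|cross| *+ 2 = \sum_(x in [set: 'I_t]) \sum_(y in [set: 'I_t])
    (L x y && (p x != p y)))%N.
  pose F (A : {set 'I_t}) : nat := (if insub A is Some e
    then (R e == low_palette r) && ~~ joined (val e) else false).
  have <- : \sum_(e : edge 'I_t) F (val e) = #|cross|.
    rewrite -sum1_card [RHS]big_mkcond; apply: eq_bigr => e _.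
    by rewrite /F valK inE; case: (_ && _).
  rewrite -sum_pairs_edge sumT; apply: eq_bigr => x _.
  rewrite sumT big_mkcond; apply: eq_bigr => y _; rewrite /L.
  case: ifP => //= xy; rewrite /F /colours; case: insubP => [e _ /= ->|].
    by rewrite /joined preim_partition_pair.
  by rewrite cards2 xy.
have BE : (#|nonextremal_edges R| *+ 2 =
    \sum_(x in [set: 'I_t]) \sum_(y in [set: 'I_t]) B x y)%N.
  rewrite -[#|_|]sum1_card big_mkcond.
  rewrite (eq_bigr (fun e => (~~ extremal (R e) : nat))) => [|e _].
    rewrite -(sum_colours R (fun A => (~~ extremal A : nat))).
    by apply: eq_bigr => x _; apply: eq_bigr => y _; rewrite /B; case: ifP.
  by rewrite inE; case: (extremal _).
have hD : (#|D| <= #|nonextremal_edges R| + #|cross|)%N.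
  by rewrite (leq_trans (subset_leq_card sD)) // cardsU leq_subr.
rewrite -crossE -BE in pE.
have {}pE : (#|cross| + #|cross| <=
    2 * (#|nonextremal_edges R| + #|nonextremal_edges R|))%N by exact: pE.
lia.
Qed.

(** * Choice of constants and the stability estimate *)

Theorem theorem4p13 (K : realType) (r : nat) (hr : (3 <= r)%N)
    (delta : K) (hdelta : 0 < delta) :
  exists (eps : K) (M : nat), [/\ 0 < eps, eps < 1 &
    forall t : nat, (M < t)%N ->
    forall R : r_graph 'I_t r, Mtilde R ->
      (m r)%:R `^ ((1 - eps) * 'C(t, 2)%:R) < (weight R)%:R :> K ->
      exists R' : r_graph 'I_t r, Ctilde R' /\ delta_close delta R R'].
Proof.
have [kap [C [kap0 C0 hN]]] := irregular_edges_bound K hr.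
have m2 := m_gt1 hr; pose lm : K := ln (m r)%:R.
have lm0 : 0 < lm by rewrite ln_gt0 // ltr1n.
(* Makes the quadratic error 6 eps ln(m) t^2 at most half of kap delta t^2; the cap 1/2 keeps [eps]
   below 1. *)
pose eps := Num.min (1 / 2) (delta * kap / (12 * lm)).
have eps0 : 0 < eps.
  by rewrite lt_min !divr_gt0 ?mulr_gt0.
have eps_le : 12 * lm * eps <= delta * kap.
  by rewrite -ler_pdivlMl ?mulr_gt0 // mulrC ge_min lexx orbT.
(* Beyond this threshold the linear error (6C + 3 kap) t is at most the other half. *)
pose x := 2 * (6 * (C / kap) + 3) / delta.
have x0 : 0 <= x.
  have Ckap0 : 0 <= C / kap by rewrite divr_ge0 // ltW.
  by rewrite /x divr_ge0 ?(ltW hdelta) //; lra.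
exists eps, (Num.bound x); split=> //.
  by rewrite gt_min; apply/orP; left; lra.
move=> t hMt R hR hW; have [R' [hR' hdiff]] := Ctilde_near hr hR.
exists R'; split=> //; rewrite /delta_close card_ord.
have t0 : (0 < t)%N by apply: leq_ltn_trans hMt.
have := leq_trans hdiff (leq_mul (leqnn 3) (nonextremal_edges_bound hr hR)).
rewrite -(ler_nat K) natrM natrD natrM; set d := #|_|%:R; set N := #|_|%:R => {}hdiff.
have W0 : 0 < (weight R)%:R :> K by apply: le_lt_trans hW; apply: powR_ge0.
have lnW : (1 - eps) * 'C(t, 2)%:R * lm < ln (weight R)%:R.
  have mpos : 0 < (m r)%:R :> K by rewrite ltr0n (ltnW m2).
  by rewrite /lm -ln_powR ltr_ln // posrE // powR_gt0.
have {}hN : kap * N <= C * t%:R + eps * lm * t%:R ^+ 2.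
  have bin : 'C(t, 2)%:R <= t%:R ^+ 2 :> K.
    by rewrite -natrX ler_nat bin2_le_sqr.
  have := ler_wpM2l (ltW (mulr_gt0 eps0 lm0)) bin.
  have := hN t R hR; rewrite -/lm -/N; lra.
have tbig : 2 * (6 * (C / kap) + 3) <= delta * t%:R.
  rewrite [leRHS]mulrC -ler_pdivrMr //; apply: ltW; apply: lt_trans (archi_boundP x0) _.
  by rewrite ltr_nat.
have t1 : 0 < t%:R :> K by rewrite ltr0n.
rewrite -(ler_pM2l kap0).
have h1 : 2 * (6 * C + 3 * kap) * t%:R <= kap * delta * t%:R ^+ 2.
  rewrite expr2 mulrA ler_pM2r //.
  have := ler_wpM2l (ltW kap0) tbig.
  have -> : kap * (2 * (6 * (C / kap) + 3)) = 2 * (6 * C + 3 * kap).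
    by field; rewrite gt_eqF.
  by rewrite mulrA.
have h2 := ler_wpM2r (exprn_ge0 2 (ltW t1)) eps_le.
have h3 := ler_wpM2l (ltW kap0) hdiff.
lra.
Qed.
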